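(* For every $k\ge 0$, let $$r_k(x)=\begin{cases} q_k(x)/(x-1), & \text{if } k\equiv 1 \pmod 3,\\ q_k(x), & \text{otherwise}.\end{cases}$$ Then $r_k(x)$ is a polynomial in $\mathbb{Z}[x]$ that is irreducible over $\mathbb{Q}$. In particular $r_k$ is the minimal polynomial of $d_k$.
   Context: Define $q_k(x)\in\mathbb{Z}[x]$ by $q_0(x)=x^2-5x+3$, $q_1(x)=(x^3-8x^2+17x-5)(x-1)$, and $q_k(x)=(x^2-4x+2)q_{k-1}(x)-q_{k-2}(x)$ for $k\ge 2$. Let $d_k$ denote the largest real root of $q_k$ (in the source, $q_k$ is the characteristic polynomial of $A_k^tA_k$ divided by $(x-2)^2$ for the adjacency matrix $A_k$ of a certain bipartite graph, and $d_k$ is the square of its Perron–Frobenius eigenvalue). *)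

(* Defs.v *)
From HB Require Import structures.
From mathcomp Require Import all_boot all_order all_algebra.
Set Implicit Arguments. Unset Strict Implicit. Unset Printing Implicit Defensive.
Import Order.TTheory GRing.Theory Num.Theory.
Local Open Scope ring_scope.

Fixpoint q_pair (k : nat) : {poly int} * {poly int} :=
  match k with
  | 0%N => ('X^2 - 5%:P * 'X + 3%:P,
            ('X^3 - 8%:P * 'X^2 + 17%:P * 'X - 5%:P) * ('X - 1))
  | k'.+1 => let (a, b) := q_pair k' in
             (b, ('X^2 - 4%:P * 'X + 2%:P) * b - a)
  end.

Definition q (k : nat) : {poly int} := (q_pair k).1.

Definition r (k : nat) : {poly int} :=
  if (k %% 3 == 1)%N then q k %/ ('X - 1) else q k.

(* Main.v *)
Require Import Defs.
From HB Require Import structures.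
From mathcomp Require Import all_boot all_order all_algebra all_field.
From mathcomp Require Import ring lra zify.
Set Implicit Arguments. Unset Strict Implicit. Unset Printing Implicit Defensive.
Import Order.TTheory GRing.Theory Num.Theory.
Local Open Scope ring_scope.

(* Put x = s + 1/s + 2, N = 4k + 5, f(s) = s^3 - s^2 - s - 1 (trib) and
   g(s) = s^3 f(1/s) (cotrib).  Solving the recurrence gives
     s^(2k+2) (s^4 - 1) q_k(x) = s^N f(s) - g(s).
   The right-hand side has at most one zero in the open unit disc, so the
   conjugates of a zero x of q_k either come from |s| = 1 only, and then s is a
   root of unity by Kronecker's theorem, or include that unique exceptional
   zero.  A Galois argument shows that the only root of unity that contributes
   is a primitive cube root of 1, that is x = 1.  Finally the zeros of q_k are
   simple because q_k is separable modulo 2.  Hence every factor of r_k over Q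
   vanishes at the exceptional zero, and no two cofactors can. *)

(** * Kronecker's theorem on algebraic integers with all conjugates in the closed unit disc *)

(** Let d be the gcd of p and p', with p = e d. If x is a zero of e, then p divides e and d is
    constant. If x is a zero of d, then p divides p', which is nonzero of smaller degree in
    characteristic 0. *)
Lemma separable_minCpoly (x : algC) : separable_poly (minCpoly x).
Proof.
have := size_minCpoly x.
have [p [-> mon_p] min_p] := minCpolyP x; rewrite size_map_poly => s1.
rewrite separable_map separable_poly.unlock /coprimep.
have p0 := monic_neq0 mon_p.
have px : root (map_poly ratr p) x by rewrite min_p.
set d := gcdp p p^`(); have /dvdpP[e De] : d %| p by exact: dvdp_gcdl.
have /norP[e0 d0] : ~~ ((e == 0) || (d == 0)) by rewrite -mulf_eq0 -De.
have : root (map_poly ratr e) x || root (map_poly ratr d) x.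
  by rewrite -rootM -rmorphM -De.
rewrite !min_p => /orP[/(dvdp_leq e0)|pd].
  rewrite {1}De size_mul // (polySpred d0) (polySpred e0) addnS addSn /=.
  by rewrite ltnS -{2}[(size e).-1]addn0 leq_add2l leqn0 => /eqP->.
have p'0 : p^`() != 0.
  apply/eqP => /polyP/(_ (size p).-2); rewrite coef_deriv coef0 prednK ?ltn_predRL //.
  by move/eqP; rewrite mulrn_eq0 -lead_coefE lead_coef_eq0 (negPf p0); case: (size p) s1 => [|[]].
have := dvdp_leq p'0 (dvdp_trans pd (dvdp_gcdr _ _)).
by rewrite leqNgt lt_size_deriv.
Qed.

(** The inverse Vandermonde matrix recovers the coefficients from the values at n distinct points,
    so the sum of the norms of its entries bounds them. *)
Lemma coef_bound (n : nat) (a : 'I_n -> algC) : injective a ->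
  exists B : nat, forall v : {poly algC}, (size v <= n)%N ->
    (forall i, `|v.[a i]| <= 1) -> forall j : 'I_n, `|v`_j| <= B%:R.
Proof.
move=> inj_a.
pose V := Vandermonde n (\row_i a i); have uV : V \in unitmx.
  rewrite unitmxE det_Vandermonde unitfE; apply/prodf_neq0 => i _.
  apply/prodf_neq0 => j ij; rewrite !mxE subr_eq0; apply: contraTneq ij => /inj_a->.
  by rewrite ltnn.
pose C : algC := \sum_i \sum_j `|invmx V i j|.
have C0 : 0 <= C by apply: sumr_ge0 => i _; apply: sumr_ge0 => j _; exact: normr_ge0.
exists (Num.bound C) => v sv v1 j.
have Dv : \row_(l < n) v`_l = (\row_i v.[a i]) *m invmx V.
  apply: (canRL (mulmxK uV)); apply/rowP => i; rewrite !mxE.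
  rewrite (horner_coef_wide _ sv); apply: eq_bigr => l _; by rewrite !mxE.
have -> : v`_j = ((\row_i v.[a i]) *m invmx V) 0 j by rewrite -Dv mxE.
apply: (@le_trans _ _ C); last first.
  exact/ltW/archi_boundP.
rewrite mxE; apply: le_trans (ler_norm_sum _ _ _) _.
apply: ler_sum => i _; rewrite normrM mxE (bigD1 j) //=.
apply: ler_wpDr; first by apply: sumr_ge0.
by rewrite -[leRHS]mul1r ler_wpM2r.
Qed.

(* The residues of X^j modulo the minimal polynomial are integral and take values
   of norm at most 1 at the conjugates of s, so there are finitely many. *)
Lemma kronecker_unity (s : algC) : s \in Aint -> s != 0 ->
  (forall t, root (minCpoly s) t -> `|t| <= 1) ->
  exists2 n, (0 < n)%N & s ^+ n = 1.
Proof.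
move=> Zs s0 le1; have /floorpP[M DM] := Zs.
have [rs Drs] := closed_field_poly_normal (minCpoly s).
rewrite (monicP (minCpoly_monic s)) scale1r in Drs.
have Urs : uniq rs by rewrite -separable_prod_XsubC -Drs separable_minCpoly.
have rootE t : root (minCpoly s) t = (t \in rs) by rewrite Drs root_prod_XsubC.
have sM : size M = (size rs).+1.
  have /(congr1 (size : {poly algC} -> nat)) := Drs.
  rewrite size_prod_XsubC DM size_map_inj_poly //; first exact: intr_inj.
have mon_M : M \is monic.
  have := minCpoly_monic s; rewrite DM !monicE lead_coef_map_inj //.
    by rewrite -[1]/(1%:~R) eqr_int.
  exact: intr_inj.
pose v j : {poly int} := Pdiv.Ring.rmodp 'X^j M.
have sv j : (size (v j) <= size rs)%N.
  by rewrite -ltnS -sM Pdiv.Ring.ltn_rmodpN0 // monic_neq0.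
have vE j t : t \in rs -> (map_poly intr (v j)).[t] = t ^+ j.
  rewrite -rootE DM => /rootP Mt.
  have := congr1 (fun p => (map_poly (intr : int -> algC) p).[t])
             (Pdiv.RingMonic.rdivp_eq mon_M 'X^j).
  by rewrite rmorphD rmorphM /= map_polyXn !hornerE Mt mulr0 add0r => <-.
pose a (i : 'I_(size rs)) := rs`_i.
have inj_a : injective a.
  by move=> i j /eqP; rewrite nth_uniq // => /eqP /val_inj.
have [B boundB] := @coef_bound (size rs) a inj_a.
have vB j (i : 'I_(size rs)) : (absz ((v j)`_i)%R <= B)%N.
  have := boundB (map_poly intr (v j)).
  rewrite size_map_inj_poly //; last exact: intr_inj.
  move/(_ (sv j)) => /(_ _ i); rewrite coef_map /= -intr_norm -abszE => bnd.
  suff : ((absz ((v j)`_i)%R)%:~R : algC) <= B%:R.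
    by rewrite -[B%:R]/(B%:~R) ler_int lez_nat.
  apply: bnd => l; rewrite vE ?mem_nth // normrX exprn_ile1 //.
  by apply: le1; rewrite rootE mem_nth.
(* Shifting by B moves the coefficients from [-B, B] into [0, 2B], so the residues are encoded in a
   finite type and the pigeonhole principle applies. *)
pose code j := [ffun i : 'I_(size rs) =>
  inord (absz ((v j)`_i + B%:Z)) : 'I_(2 * B).+1].
have codeP j l : code j = code l -> v j = v l.
  move=> /ffunP eq_c; apply/polyP => i.
  have [lt_i|ge_i] := ltnP i (size rs); last first.
    by rewrite !nth_default // (leq_trans (sv _) ge_i).
  have := eq_c (Ordinal lt_i); rewrite !ffunE => /(congr1 val) /=.
  have := vB j (Ordinal lt_i); have := vB l (Ordinal lt_i) => /= b1 b2.
  rewrite !inordK; lia.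
have [j [l [lt_jl eq_jl]]] : exists j l, (j < l)%N /\ v j = v l.
  pose n := #|{ffun 'I_(size rs) -> 'I_(2 * B).+1}|.
  have /injectivePn[j [l neq_jl eq_jl]] :
      ~~ injectiveb (fun j : 'I_n.+1 => code j).
    apply/injectiveP => /leq_card; by rewrite card_ord ltnn.
  move: eq_jl neq_jl => /codeP eq_jl; rewrite -val_eqE neq_ltn => /orP[lt|lt].
    by exists j, l.
  by exists l, j.
exists (l - j)%N; first by rewrite subn_gt0.
have s_rs : s \in rs by rewrite -rootE root_minCpoly.
apply: (mulfI (expf_neq0 j s0)); rewrite mulr1 -exprD subnKC; last exact: ltnW.
by rewrite -!vE // eq_jl.
Qed.

(** * The recurrence for [q], and its values in a commutative ring *)

Lemma q_pairE k : q_pair k = (q k, q k.+1).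
Proof. by rewrite /q /=; case: (q_pair k). Qed.

Lemma qS k : q k.+2 = ('X^2 - 4%:P * 'X + 2%:P) * q k.+1 - q k.
Proof. by rewrite {1}/q /= q_pairE. Qed.

Lemma q_ind (P : nat -> Prop) :
  P 0%N -> P 1%N -> (forall k, P k -> P k.+1 -> P k.+2) -> forall k, P k.
Proof.
by move=> P0 P1 PS k; suff [] : P k /\ P k.+1 by []; elim: k => [|k []]; auto.
Qed.

Lemma q0 : q 0 = 'X^2 - 5%:P * 'X + 3%:P.
Proof. by []. Qed.

Lemma q1 : q 1 = ('X^3 - 8%:P * 'X^2 + 17%:P * 'X - 5%:P) * ('X - 1).
Proof. by []. Qed.

Section Evaluation.
Context {R : comNzRingType} (x : R).

Local Notation qR k := (map_poly (intr : int -> R) (q k)).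
Definition qv k := (qR k).[x].
Definition dqv k := (qR k)^`().[x].

Let map_nat (n : nat) : map_poly (intr : int -> R) n%:R%:P = n%:R%:P.
Proof. by rewrite map_polyC /= !rmorph_nat. Qed.

Let qR0 : qR 0 = 'X^2 - 5%:R%:P * 'X + 3%:R%:P.
Proof.
rewrite q0 rmorphD rmorphB /= map_polyXn rmorphM /=.
by rewrite map_polyX !map_nat.
Qed.

Let qR1 : qR 1 =
  ('X^3 - 8%:R%:P * 'X^2 + 17%:R%:P * 'X - 5%:R%:P) * ('X - 1).
Proof.
rewrite q1 rmorphM !rmorphB rmorphD rmorphB rmorph1 /= map_polyXn.
by rewrite rmorphM /= map_polyXn rmorphM /= map_polyX !map_nat.
Qed.

Let qRS k : qR k.+2 = ('X^2 - 4%:R%:P * 'X + 2%:R%:P) * qR k.+1 - qR k.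
Proof.
rewrite qS rmorphB rmorphM rmorphD rmorphB /= map_polyXn rmorphM /=.
by rewrite map_polyX !map_nat.
Qed.

Lemma qv0 : qv 0 = x ^+ 2 - 5 * x + 3.
Proof. by rewrite /qv qR0 !hornerE. Qed.

Lemma qv1 : qv 1 = (x ^+ 3 - 8 * x ^+ 2 + 17 * x - 5) * (x - 1).
Proof. by rewrite /qv qR1 !hornerE. Qed.

Lemma qvS k : qv k.+2 = (x ^+ 2 - 4 * x + 2) * qv k.+1 - qv k.
Proof. by rewrite /qv qRS !hornerE. Qed.

Let derE := (derivM, derivB, derivD, derivXn, derivX, derivC).
Let horE := (hornerM, hornerD, hornerN, hornerMn, hornerXn, hornerX, hornerC).

Lemma dqv0 : dqv 0 = 2 * x - 5.
Proof. rewrite /dqv qR0 !derE !horE; ring. Qed.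

Lemma dqv1 : dqv 1 = (3 * x ^+ 2 - 16 * x + 17) * (x - 1)
                    + (x ^+ 3 - 8 * x ^+ 2 + 17 * x - 5).
Proof. rewrite /dqv qR1 !derE !horE; ring. Qed.

Lemma dqvS k : dqv k.+2 =
  (2 * x - 4) * qv k.+1 + (x ^+ 2 - 4 * x + 2) * dqv k.+1 - dqv k.
Proof. rewrite /dqv /qv qRS !derE !horE; ring. Qed.

End Evaluation.

(** * The closed form in s, and its solutions among roots of unity and in the open disc *)

Definition trib {R : nzRingType} (s : R) := s ^+ 3 - s ^+ 2 - s - 1.
Definition cotrib {R : nzRingType} (s : R) := 1 - s - s ^+ 2 - s ^+ 3.

(** At x = s + 1/s + 2 the multiplier x^2 - 4x + 2 equals s^2 + s^-2. The recurrence thus has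
    characteristic roots s^2 and s^-2, which become s^4 and 1 after scaling by s^(2k+2). *)
Lemma qv_trib (F : fieldType) (s : F) k : s != 0 ->
  qv (s + s^-1 + 2) k * s ^+ (2 * k + 2) * (s ^+ 4 - 1) =
  s ^+ (4 * k + 5) * trib s - cotrib s.
Proof.
move=> s0; rewrite /trib /cotrib.
elim/q_ind: k => [||k IH1 IH2]; first by rewrite qv0; field.
  by rewrite qv1; field.
have -> : qv (s + s^-1 + 2) k.+2 * s ^+ (2 * k.+2 + 2) * (s ^+ 4 - 1) =
  (s ^+ 4 + 1) * (qv (s + s^-1 + 2) k.+1 * s ^+ (2 * k.+1 + 2) * (s ^+ 4 - 1))
  - s ^+ 4 * (qv (s + s^-1 + 2) k * s ^+ (2 * k + 2) * (s ^+ 4 - 1)).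
  rewrite qvS (_ : 2 * k.+2 + 2 = 2 * k + 6)%N; last by lia.
  rewrite (_ : 2 * k.+1 + 2 = 2 * k + 4)%N; last by lia.
  rewrite !exprD; field.
  by [].
rewrite IH1 IH2 (_ : 4 * k.+2 + 5 = 4 * k + 13)%N; last by lia.
rewrite (_ : 4 * k.+1 + 5 = 4 * k + 9)%N; last by lia.
rewrite !exprD; ring.
Qed.

(** The equation has integer coefficients, so it is preserved by the automorphism that raises n-th
    roots of unity to the power e. *)
Lemma trib_unity_aut (s : algC) (k n e : nat) : s ^+ n = 1 -> coprime e n ->
  s ^+ (4 * k + 5) * trib s = cotrib s ->
  (s ^+ e) ^+ (4 * k + 5) * trib (s ^+ e) = cotrib (s ^+ e).
Proof.
move=> sn1 /Qn_aut_exists[u /(_ s sn1) us] /(congr1 u).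
by rewrite /trib /cotrib !(rmorphM, rmorphB, rmorphXn, rmorph1) /= us.
Qed.

Lemma prim_root_halfN (s : algC) (m : nat) : (0 < m)%N ->
  (2 * m).-primitive_root s -> s ^+ m = -1.
Proof.
move=> m0 prim_s; have := prim_expr_order prim_s.
rewrite mulnC exprM => /eqP; rewrite sqrf_eq1 => /orP[|/eqP//].
rewrite -(prim_order_dvd prim_s) => /dvdn_leq; lia.
Qed.

(* An automorphism of algC acts on s as s |-> s^e with e prime to the order n of
   s; e is chosen so that s^e is s^2, -s or -s^2 according as n is odd, 4 | n or
   n = 2 mod 4.  Eliminating s^N between the equation and its image leaves a
   polynomial equation independent of N. *)
Lemma trib_unity (s : algC) (k n : nat) : (0 < n)%N -> s ^+ n = 1 ->
  s ^+ (4 * k + 5) * trib s = cotrib s ->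
  s ^+ 4 = 1 \/ s ^+ 2 + s + 1 = 0.
Proof.
move=> n0 /(prim_order_exists n0)[{n0}n prim_s _] E.
have n0 := prim_order_gt0 prim_s.
have sn1 := prim_expr_order prim_s.
have s0 : s != 0.
  apply/eqP => z; move/eqP: sn1; rewrite z expr0n gtn_eqF //= eq_sym.
  by rewrite oner_eq0.
pose w := s ^+ (4 * k + 5); have Ew : w * trib s = cotrib s by [].
have mulI (a b : algC) : a != 0 -> a * b = 0 -> b = 0.
  by move=> a0 /eqP; rewrite mulf_eq0 (negPf a0) => /eqP.
have n2 : (2 : algC) != 0 by rewrite pnatr_eq0.
have q4 (u v : algC) : u = 0 -> s ^+ 4 - 1 = u * v -> s ^+ 4 = 1.
  by move=> -> /eqP; rewrite mul0r subr_eq0 => /eqP.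
have [odd_n|even_n] := boolP (odd n).
  have := trib_unity_aut sn1 (_ : coprime 2 n) E.
  rewrite coprime2n => /(_ odd_n); rewrite exprAC -/w => E2.
  (* With g(s) = w f(s) and g(s^2) = w^2 f(s^2), the difference g(s)^2 f(s^2) - f(s)^2 g(s^2)
     vanishes. It factors into cyclotomic polynomials, up to the constant 2. The other two cases are
     analogous. *)
  have : 2 * ((s - 1) ^+ 3 * (s + 1) * (s ^+ 2 + s + 1) ^+ 2 * (s ^+ 2 + 1) ^+ 2)
     = 0.
    transitivity (cotrib s ^+ 2 * trib (s ^+ 2) - trib s ^+ 2 * cotrib (s ^+ 2)).
      rewrite /trib /cotrib; ring.
    rewrite -Ew -E2; ring.
  move/(mulI _ _ n2)/eqP; rewrite !(expf_eq0, mulf_eq0) /=.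
  move=> /orP[/orP[/orP[]|]|] /eqP e; [left|left|by right|left].
  - apply: (q4 _ ((s + 1) * (s ^+ 2 + 1)) e); ring.
  - apply: (q4 _ ((s - 1) * (s ^+ 2 + 1)) e); ring.
  - apply: (q4 _ (s ^+ 2 - 1) e); ring.
pose m := n./2; have Dn : n = (2 * m)%N by rewrite /m; lia.
have m0 : (0 < m)%N by lia.
have sm : s ^+ m = -1 by apply: prim_root_halfN m0 _; rewrite -Dn.
have oddX (x : algC) : (- x) ^+ (4 * k + 5) = - x ^+ (4 * k + 5).
  by rewrite exprNn -signr_odd oddD oddM /= expr1 mulN1r.
have [odd_m|even_m] := boolP (odd m); last first.
  have co : coprime m.+1 n.
    by rewrite Dn coprimeMr coprimeSn andbT coprimen2 /= even_m.
  have := trib_unity_aut sn1 co E.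
  rewrite exprSr sm mulN1r oddX -/w => E2.
  have : 2 * ((s ^+ 4 - 1) * (1 + s ^+ 2)) = 0.
    transitivity (cotrib s * trib (- s) + trib s * cotrib (- s)).
      rewrite /trib /cotrib; ring.
    rewrite -Ew -E2; ring.
  move/(mulI _ _ n2)/eqP; rewrite mulf_eq0 => /orP[]/eqP e; left.
    by apply: (q4 _ (1 : algC) e); ring.
  apply: (q4 _ (s ^+ 2 - 1) e); ring.
have co : coprime m.+2 n.
  rewrite Dn coprimeMr coprimen2 /= negbK odd_m /=.
  by rewrite -addn2 coprime_sym /coprime gcdnDl -/(coprime m 2) coprimen2.
have De : s ^+ m.+2 = - s ^+ 2 by rewrite -addn2 exprD sm mulN1r.
have := trib_unity_aut sn1 co E; rewrite De oddX exprAC -/w => E2.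
have : 2 * (s * ((s - 1) * (s + 1) ^+ 3 * (s ^+ 2 + 1)
              * (2 * s ^+ 4 - s ^+ 3 - s + 2))) = 0.
  transitivity (- (cotrib s ^+ 2 * trib (- s ^+ 2) + trib s ^+ 2 * cotrib (- s ^+ 2))).
    rewrite /trib /cotrib; ring.
  rewrite -Ew -E2; ring.
move/(mulI _ _ n2)/(mulI _ _ s0)/eqP; rewrite !(expf_eq0, mulf_eq0) /=.
move=> /orP[/orP[/orP[]|]|] /eqP e; [left|left|left|exfalso].
- apply: (q4 _ ((s + 1) * (s ^+ 2 + 1)) e); ring.
- apply: (q4 _ ((s - 1) * (s ^+ 2 + 1)) e); ring.
- apply: (q4 _ (s ^+ 2 - 1) e); ring.
(* The remaining quartic is not cyclotomic, so the automorphism s |-> -s^2 is applied to it once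
   more. With y = s + 1/s the quartic reads 2y^2 - y - 4 = 0, and modulo this its image reads y^2 +
   y - 8 = 0. Together they force y = 4, where the former has the value 24. *)
have e2 : 2 * s ^+ 8 + s ^+ 6 + s ^+ 2 + 2 = 0.
  have [u /(_ s sn1) us] := Qn_aut_exists co.
  have := congr1 u e; rewrite !(rmorphD, rmorphN, rmorphM, rmorphXn) /=.
  rewrite !rmorph1 us De rmorph0 => <-; ring.
have e3 : s ^+ 2 - 4 * s + 1 = 0.
  apply: (mulI (3 * s ^+ 3)).
    by rewrite mulf_neq0 ?expf_neq0 // pnatr_eq0.
  transitivity (4 * (2 * s ^+ 8 + s ^+ 6 + s ^+ 2 + 2)
     - (2 * s ^+ 4 - s ^+ 3 - s + 2) * (4 * (s ^+ 4 + 2 * s ^+ 2 + 1)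
        + 2 * (s ^+ 3 + s) - 5 * s ^+ 2)); first by ring.
  by rewrite e2 e; ring.
have : 24 * s ^+ 2 = 0.
  transitivity ((2 * s ^+ 4 - s ^+ 3 - s + 2)
    - (s ^+ 2 - 4 * s + 1) * (2 * s ^+ 2 + 7 * s + 2)); first by ring.
  by rewrite e e3; ring.
by move/eqP; rewrite mulf_eq0 expf_eq0 (negPf s0) pnatr_eq0.
Qed.

(* The form f(x) f(y)^* - g(x) g(y)^* equals 1 - x y^* times a Hermitian form in
   (1, x, x^2) with exactly one positive square, whereas on the span of two
   zeros it is 1 - x y^* times a sum of squares. *)
Lemma trib_disc_unique (N : nat) (s t : algC) : (0 < N)%N ->
  `|s| < 1 -> `|t| < 1 ->
  s ^+ N * trib s = cotrib s -> t ^+ N * trib t = cotrib t -> s = t.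
Proof.
move=> N0 s1 t1 Es Et.
pose l (x : algC) := 1 + x + x ^+ 2.
have K (x y : algC) : `|x| < 1 -> `|y| < 1 ->
    x ^+ N * trib x = cotrib x -> y ^+ N * trib y = cotrib y ->
    trib x * (trib y)^* * (\sum_(j < N) (x * y^*) ^+ j) =
    2 * (l x * (l y)^* - 1 - x * y^* - (x * y^*) ^+ 2).
  move=> x1 y1 Ex Ey; have c1 : x * y^* - 1 != 0.
    rewrite subr_eq0; apply/negP => /eqP/(congr1 Num.norm).
    rewrite normrM norm_conjC normr1 => e.
    have : `|x| * `|y| < 1 by rewrite mulr_ilt1.
    by rewrite e ltxx.
  apply: (mulfI c1); rewrite mulrCA -subrX1 exprMn.
  transitivity ((x ^+ N * trib x) * (y ^+ N * trib y)^* - trib x * (trib y)^*).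
    rewrite rmorphM rmorphXn /=; ring.
  rewrite Ex Ey /trib /cotrib /l.
  rewrite !(rmorphD, rmorphN, rmorphM, rmorphXn, rmorph1) /=; ring.
have l0 x : `|x| < 1 -> l x != 0.
  move=> x1; apply/negP => /eqP lx.
  have /(congr1 Num.norm) : x ^+ 3 = 1.
    have e : x ^+ 3 - 1 = (x - 1) * l x by rewrite /l; ring.
    by apply/eqP; rewrite -subr_eq0 e lx mulr0.
  rewrite normrX normr1 => /eqP; rewrite pexpr_eq1 // => /eqP e.
  by rewrite e ltxx in x1.
(* With these coefficients the positive square cancels. *)
pose a := l t; pose b := - l s.
have Q : \sum_(j < N) `|a * trib s * s ^+ j + b * trib t * t ^+ j| ^+ 2 =
    - 2 * (`|a + b| ^+ 2 + `|a * s + b * t| ^+ 2 + `|a * s ^+ 2 + b * t ^+ 2| ^+ 2).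
  transitivity (
      a * a^* * (trib s * (trib s)^* * \sum_(j < N) (s * s^*) ^+ j)
    + a * b^* * (trib s * (trib t)^* * \sum_(j < N) (s * t^*) ^+ j)
    + b * a^* * (trib t * (trib s)^* * \sum_(j < N) (t * s^*) ^+ j)
    + b * b^* * (trib t * (trib t)^* * \sum_(j < N) (t * t^*) ^+ j)).
    rewrite !big_distrr -!big_split /=; apply: eq_bigr => j _.
    rewrite normCK rmorphD !rmorphM !rmorphXn /= !exprMn; ring.
  rewrite !K // !normCK /a /b /l.
  rewrite !(rmorphD, rmorphN, rmorphM, rmorphXn, rmorph1) /=; ring.
have : \sum_(j < N) `|a * trib s * s ^+ j + b * trib t * t ^+ j| ^+ 2 >= 0.
  by apply: sumr_ge0 => j _; rewrite exprn_ge0.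
rewrite Q mulNr oppr_ge0 pmulr_rle0 // => le0.
have sq0 (x : algC) : 0 <= `|x| ^+ 2 by rewrite exprn_ge0.
(* A nonnegative sum equals -2 times a sum of squares, so each of these squares is zero. The first
   two already give a (s - t) = 0, where a = l(t) is nonzero. *)
have : `|a + b| ^+ 2 + `|a * s + b * t| ^+ 2 + `|a * s ^+ 2 + b * t ^+ 2| ^+ 2 == 0.
  by rewrite eq_le le0 !addr_ge0.
rewrite !paddr_eq0 ?addr_ge0 // !expf_eq0 /= !normr_eq0.
case/andP => /andP[/eqP ab /eqP abst] _.
have : a * (s - t) = 0.
  transitivity (a * s + b * t - t * (a + b)); first by ring.
  by rewrite abst ab; ring.
by move/eqP; rewrite mulf_eq0 (negPf (l0 _ t1)) subr_eq0 => /eqP.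
Qed.

(** * Simplicity of the zeros of [q], by reduction modulo 2 *)

Lemma Aint_horner (p : {poly int}) (x : algC) :
  x \in Aint -> (map_poly intr p).[x] \in Aint.
Proof.
move=> Zx; apply: rpred_horner => //.
by apply/polyOverP => i; rewrite coef_map /= Aint_int.
Qed.

(** A rational algebraic integer is an integer, and 1/2 is not one. Hence congruence modulo 2 among
    algebraic integers is not trivial. *)
Lemma half_notin_Aint (w : algC) : w \in Aint -> 2 * w != 1.
Proof.
move=> Zw; apply/negP => /eqP e.
have n2 : (2 : algC) != 0 by rewrite pnatr_eq0.
have Dw : w = 2^-1 by apply: (mulfI n2); rewrite e mulfV.
have /intrP[m Dm] : w \in Num.int.
  by apply: Cint_rat_Aint Zw; rewrite Dw rpredV rpred_nat.
have : (2 * m)%:~R = 1%:~R :> algC by rewrite rmorphM /= -Dm.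
by move/intr_inj; lia.
Qed.

(* Modulo 2, with x = s + 1/s, the polynomials [q k] and [odd_sum k] are the
   sums of s^j over |j| <= 2k+2 and over |j| <= 2k+1. *)
Fixpoint odd_sum {R : nzRingType} (x : R) (k : nat) : R * R :=
  if k is k'.+1 then
    let (a, b) := odd_sum x k' in (b, x ^+ 2 * b - a)
  else (x + 1, x ^+ 3 + x ^+ 2 + 1).

(** Write c for the first component of [odd_sum]. Modulo 2, x^2 q' is congruent to q + c, so at a
    double zero both q and c are even. A Euclidean descent then makes q_0 and c_0 even, yet these
    generate the unit ideal modulo 2. *)
Lemma q_simple_root (x : algC) k : x \in Aint -> qv x k = 0 -> dqv x k != 0.
Proof.
move=> Zx qx0; apply/negP => /eqP dqx0.
pose c j := (odd_sum x j).1.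
have cS j : c j.+2 = x ^+ 2 * c j.+1 - c j.
  by rewrite /c /=; case: (odd_sum x j).
have Zq j : qv x j \in Aint by apply: Aint_horner.
have Zdq j : dqv x j \in Aint by rewrite /dqv deriv_map; apply: Aint_horner.
have Zn n : n%:R \in Aint by rewrite rpred_nat.
have Zc j : c j \in Aint.
  elim/q_ind: j => [||j IH1 IH2]; rewrite ?cS /c /=.
  - by rewrite rpredD ?rpred1.
  - by rewrite !rpredD ?rpredX ?rpred1.
  by rewrite rpredB ?rpredM ?rpredX.
(* Divisibility by 2 in the ring of algebraic integers. *)
pose ev (z : algC) := exists2 w, w \in Aint & z = 2 * w.
have evD y z : ev y -> ev z -> ev (y + z).
  by move=> [u Zu ->] [w Zw ->]; exists (u + w); rewrite ?rpredD ?mulrDr.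
have evM y z : y \in Aint -> ev z -> ev (y * z).
  by move=> Zy [w Zw ->]; exists (y * w); rewrite ?rpredM // mulrCA.
have evN z : ev z -> ev (- z).
  by move=> [w Zw ->]; exists (- w); rewrite ?rpredN ?mulrN.
have ev2 w z : z = 2 * w -> w \in Aint -> ev z by exists w.
have evq j : ev (x ^+ 2 * dqv x j - qv x j - c j).
  elim/q_ind: j => [||j IH1 IH2].
  (* Here and below, an explicit witness given to [ev2] is half of the expanded expression. *)
  - rewrite dqv0 qv0 /c /=; apply: (@ev2 (x ^+ 3 - 3 * x ^+ 2 + 2 * x - 2)).
      by ring.
    by rewrite !(rpredB, rpredD, rpredM, rpredX).
  - rewrite dqv1 qv1 /c /=; apply: (@ev2 (2 * x ^+ 5 - 14 * x ^+ 4
      + 29 * x ^+ 3 - 24 * x ^+ 2 + 11 * x - 3)); first by ring.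
    by rewrite !(rpredB, rpredD, rpredM, rpredX).
  rewrite dqvS qvS cS; set z := (X in ev X).
  have -> : z = x ^+ 2 * (x ^+ 2 * dqv x j.+1 - qv x j.+1 - c j.+1)
    + - (x ^+ 2 * dqv x j - qv x j - c j)
    + 2 * (x ^+ 2 * (x - 2) * qv x j.+1 + (1 - 2 * x) * (x ^+ 2 * dqv x j.+1)
        - (1 - 2 * x) * qv x j.+1) by rewrite /z; ring.
  apply/evD; first by apply/evD; [apply/evM; rewrite ?rpredX|apply/evN].
  apply: (@ev2) (erefl _) _.
  by rewrite !(rpredB, rpredD, rpredM, rpredX, rpred1).
(* If S_m is the sum of s^j over |j| <= m, then S_(m+1) + S_(m-1) = (s + 1/s) S_m. Modulo 2 the
   values of c and q are the odd and even terms of this sequence. *)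
have evqc j : ev (qv x j.+1 - x * c j.+1 + qv x j) /\
              ev (c j.+1 - x * qv x j + c j).
  elim: j => [|j [IHq IHc]].
    rewrite qv0 qv1 /c /=; split.
      apply: (@ev2 (- 5 * x ^+ 3 + 13 * x ^+ 2 - 14 * x + 4)); first by ring.
      by rewrite !(rpredB, rpredD, rpredM, rpredN, rpredX).
    apply: (@ev2 (3 * x ^+ 2 - x + 1)); first by ring.
    by rewrite !(rpredB, rpredD, rpredM, rpredX, rpred1).
  have IHc' : ev (c j.+2 - x * qv x j.+1 + c j.+1).
    rewrite cS; set z := (X in ev X).
    have -> : z = - (x * (qv x j.+1 - x * c j.+1 + qv x j))
      + (c j.+1 - x * qv x j + c j) + 2 * (x * qv x j - c j).
      by rewrite /z; ring.
    apply/evD; first by apply/evD => //; apply/evN/evM.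
    by apply: (@ev2) (erefl _) _; rewrite !(rpredB, rpredM).
  split=> //; rewrite qvS; set z := (X in ev X).
  have -> : z = - (x * (c j.+2 - x * qv x j.+1 + c j.+1))
    + (qv x j.+1 - x * c j.+1 + qv x j)
    + 2 * ((1 - 2 * x) * qv x j.+1 + (x * c j.+1 - qv x j)).
    by rewrite /z; ring.
  apply/evD; first by apply/evD => //; apply/evN/evM.
  by apply: (@ev2) (erefl _) _; rewrite !(rpredB, rpredD, rpredM, rpred1).
have down j : ev (qv x j) -> ev (c j) -> ev (qv x 0) /\ ev (c 0%N).
  elim: j => // j IH eq ec; have [eq' ec'] := evqc j.
  have eqj : ev (qv x j).
    have -> : qv x j = (qv x j.+1 - x * c j.+1 + qv x j)
                       + - qv x j.+1 + x * c j.+1 by ring.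
    by apply/evD; [apply/evD => //; apply/evN|apply/evM].
  apply: IH => //.
  have -> : c j = (c j.+1 - x * qv x j + c j) + - c j.+1 + x * qv x j by ring.
  by apply/evD; [apply/evD => //; apply/evN|apply/evM].
have evqk : ev (qv x k) by rewrite qx0; apply: (@ev2 0); rewrite ?mulr0 ?rpred0.
have evck : ev (c k).
  have -> : c k = - (x ^+ 2 * dqv x k - qv x k - c k) by rewrite dqx0 qx0; ring.
  exact: evN.
have [e0 ec0] := down k evqk evck.
have [w Zw /esym/eqP] : ev 1.
  have -> : 1 = qv x 0 + (6 - x) * c 0%N + 2 * (- 4).
    by rewrite qv0 /c /=; ring.
  apply/evD; first by apply/evD => //; apply/evM; rewrite ?rpredB.
  by apply: (@ev2) (erefl _) _; rewrite rpredN.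
exact/negP/half_notin_Aint.
Qed.

(** * Degree and special values of [q] *)

Lemma leq_size_polyD (R : nzSemiRingType) (p r : {poly R}) n :
  (size p <= n)%N -> (size r <= n)%N -> (size (p + r)%R <= n)%N.
Proof. by move=> sp sr; rewrite (leq_trans (size_polyD _ _)) // geq_max sp sr. Qed.

Lemma q_monic_size k : q k \is monic /\ size (q k) = (2 * k + 3)%N.
Proof.
have monD (p r : {poly int}) n : p \is monic -> size p = n ->
    (size r < n)%N -> (p + r \is monic) * (size (p + r)%R = n).
  move=> mp <- lt_r; rewrite size_polyDl //; split=> //.
  by rewrite monicE lead_coefDl // (monicP mp).
have le_aX (a : int) n : (size (a%:P * 'X^n : {poly int})%R <= n.+1)%N.
  by rewrite mul_polyC (leq_trans (size_scale_leq _ _)) ?size_polyXn.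
have leC (a : int) : (size (a%:P : {poly int})%R <= 1)%N by rewrite size_polyC leq_b1.
have quad (a b : int) : ('X^2 - a%:P * 'X + b%:P : {poly int}) \is monic
    /\ size ('X^2 - a%:P * 'X + b%:P : {poly int}) = 3%N.
  rewrite -addrA; have [] // := @monD 'X^2 (- (a%:P * 'X) + b%:P) 3%N.
  - exact: monicXn.
  - by rewrite size_polyXn.
  by rewrite ltnS leq_size_polyD ?size_polyN ?(leq_trans (leC _)) // (le_aX _ 1%N).
elim/q_ind: k => [||k [_ s1] [m2 s2]].
- by rewrite q0.
- rewrite q1.
  have [m3 s3] : ('X^3 - 8%:P * 'X^2 + 17%:P * 'X - 5%:P : {poly int}) \is monic
    /\ size ('X^3 - 8%:P * 'X^2 + 17%:P * 'X - 5%:P : {poly int}) = 4%N.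
    rewrite -!addrA; have [] // := @monD 'X^3
      (- (8%:P * 'X^2) + (17%:P * 'X - 5%:P)) 4%N.
    + exact: monicXn.
    + by rewrite size_polyXn.
    rewrite ltnS !leq_size_polyD ?size_polyN ?(leq_trans (leC _)) ?le_aX //.
    by rewrite (leq_trans (le_aX _ 1%N)).
  have mX : ('X - 1 : {poly int}) \is monic by rewrite -polyC1 monicXsubC.
  by rewrite monicMr // size_Mmonic ?monic_neq0 // s3 -polyC1 size_XsubC.
have [mT sT] := quad 4 2.
rewrite qS; have [] // := @monD (('X^2 - 4%:P * 'X + 2%:P) * q k.+1) (- q k)
  (2 * k.+2 + 3)%N.
- by rewrite monicMr.
- by rewrite size_Mmonic ?monic_neq0 // sT s2; lia.
by rewrite size_polyN s1; lia.
Qed.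

(** At 1 the multiplier is -1, so three consecutive values sum to zero and the values cycle through
    -1, 0, 1. In characteristic 0, this locates the factor X - 1. *)
Lemma qv_at1 (R : comNzRingType) k : qv (1 : R) k = (k %% 3)%:R - 1.
Proof.
elim/q_ind: k => [||k IH1 IH2]; first by rewrite qv0 mod0n; ring.
  by rewrite qv1 modn_small //; ring.
rewrite qvS IH1 IH2; have : (k.+2 %% 3 + k.+1 %% 3 + k %% 3 = 3)%N by lia.
move/(congr1 (fun n => n%:R : R)); rewrite !natrD -addrA => /(canRL (addrK _))->; ring.
Qed.

(** The points 4, 0 and 2 are the values of s + 1/s + 2 at the fourth roots of unity, where both
    sides of [qv_trib] vanish and [q] must be evaluated directly. *)
Lemma qv_at4 (R : comNzRingType) k : qv (4 : R) k = - (2 * k + 1)%:R.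
Proof.
elim/q_ind: k => [||k IH1 IH2]; first by rewrite qv0; ring.
  by rewrite qv1; ring.
by rewrite qvS IH1 IH2 !natrD !natrM -![k.+2]addn2 -![k.+1]addn1 !natrD; ring.
Qed.

Lemma qv_at0 (R : comNzRingType) k : qv (0 : R) k = (2 * k + 3)%:R.
Proof.
elim/q_ind: k => [||k IH1 IH2]; first by rewrite qv0; ring.
  by rewrite qv1; ring.
by rewrite qvS IH1 IH2 !natrD !natrM -![k.+2]addn2 -![k.+1]addn1 !natrD; ring.
Qed.

Lemma qv_at2 (R : comNzRingType) k : qv (2 : R) k = (-1) ^+ k.+1 * (2 * k + 3)%:R.
Proof.
elim/q_ind: k => [||k IH1 IH2]; first by rewrite qv0; ring.
  by rewrite qv1; ring.
rewrite qvS IH1 IH2 !exprS !natrD !natrM -![k.+2]addn2 -![k.+1]addn1 !natrD; ring.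
Qed.

(** * Every admissible factor of [q] has a zero coming from the open disc *)

(** Salem's construction X^N f - f^*, applied to the tribonacci polynomial f and its reciprocal f^*.
    Being monic, it makes s an algebraic integer. *)
Definition salem_poly k : {poly int} := 'X^(4 * k + 5)%N * trib 'X - cotrib 'X.

Lemma salem_polyE (x : algC) k : (map_poly intr (salem_poly k)).[x] =
  x ^+ (4 * k + 5) * trib x - cotrib x.
Proof.
have -> : map_poly intr (salem_poly k) =
    'X^(4 * k + 5)%N * trib 'X - cotrib 'X :> {poly algC}.
  rewrite /salem_poly /trib /cotrib.
  by rewrite !(rmorphB, rmorphD, rmorphM, rmorphXn, rmorph1) /= !map_polyX.
by rewrite /trib /cotrib !(hornerD, hornerM, hornerN, hornerXn, hornerX, hornerC).
Qed.

Lemma salem_poly_monic k : salem_poly k \is monic.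
Proof.
have st : (size (- ('X^2 + 'X + 1 : {poly int})%R)%R <= 3)%N.
  by rewrite size_polyN !leq_size_polyD ?size_polyXn ?size_polyX ?size_poly1.
have Dt : trib 'X = 'X^3 + - ('X^2 + 'X + 1) :> {poly int} by rewrite /trib; ring.
have stX : size (trib 'X : {poly int}) = 4%N.
  by rewrite Dt size_polyDl size_polyXn.
have mt : trib 'X \is @monic int.
  by rewrite monicE Dt lead_coefDl ?size_polyXn // lead_coefXn.
have mN : 'X^(4 * k + 5)%N * trib 'X \is @monic int by rewrite monicMl ?monicXn.
rewrite /salem_poly monicE lead_coefDl ?(monicP mN) //.
rewrite size_Mmonic ?monic_neq0 ?monicXn // stX size_polyXn size_polyN.
have le4 : (size (cotrib 'X : {poly int})%R <= 4)%N.
  rewrite /cotrib !leq_size_polyD ?size_polyN ?size_polyXn ?size_polyX //.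
  by rewrite size_poly1.
by rewrite (leq_ltn_trans le4); lia.
Qed.

Lemma ratr_intr_poly (p : {poly int}) :
  map_poly ratr (map_poly intr p : {poly rat}) = map_poly intr p :> {poly algC}.
Proof. by rewrite -map_poly_comp; apply: eq_map_poly => b; rewrite /= rmorph_int. Qed.

Lemma q_root_trib (s : algC) k : s != 0 -> qv (s + s^-1 + 2) k = 0 ->
  s ^+ (4 * k + 5) * trib s = cotrib s.
Proof.
by move=> s0 e; apply/eqP; rewrite -subr_eq0 -qv_trib // e !mul0r.
Qed.

(** With y = x - 2, the numbers s and y - s are the roots of S^2 - y S + 1, so their product is
    1. *)
Lemma joukowski_surj (x : algC) : exists2 s, s != 0 & x = s + s^-1 + 2.
Proof.
pose y := x - 2; pose s := (y + sqrtC (y ^+ 2 - 4)) / 2.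
have Es : s * (y - s) = 1.
  have := sqrtCK (y ^+ 2 - 4); rewrite /s; move: (sqrtC _) => z Ez.
  transitivity ((y ^+ 2 - z ^+ 2) / 4); first by field.
  by rewrite Ez; field.
have s0 : s != 0.
  by apply/eqP => z; move/eqP: Es; rewrite z mul0r eq_sym oner_eq0.
exists s => //; have -> : s^-1 = y - s by apply: (mulfI s0); rewrite Es mulfV.
by rewrite /y; ring.
Qed.

(* The polynomial X^d p(X + 1/X + 2), where d is the degree of p. *)
Definition joukowski_poly (p : {poly rat}) : {poly rat} :=
  \sum_(i < size p) p`_i *: ('X^((size p).-1 - i) * ('X + 1) ^+ (2 * i)).

Lemma joukowski_polyE (p : {poly rat}) (t : algC) : t != 0 ->
  (map_poly ratr (joukowski_poly p)).[t] =
  t ^+ (size p).-1 * (map_poly ratr p).[t + t^-1 + 2].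
Proof.
move=> t0; rewrite /joukowski_poly rmorph_sum horner_sum /=.
rewrite horner_coef size_map_poly big_distrr; apply: eq_bigr => i _ /=.
rewrite map_polyZ rmorphM !rmorphXn rmorphD rmorph1 /= map_polyX.
rewrite hornerZ hornerM !horner_exp hornerD hornerX hornerC coef_map /=.
have le_i : (i <= (size p).-1)%N by rewrite -ltnS (ltn_predK (ltn_ord i)).
have -> : (t + 1) ^+ (2 * i) = t ^+ i * (t + t^-1 + 2) ^+ i.
  by rewrite exprM -exprMn; congr (_ ^+ _); field.
rewrite -{2}(subnK le_i) exprD mulrCA -mulrA; congr (_ * _).
exact: mulrCA.
Qed.

(** Inversion exchanges [trib] and [cotrib] up to the factor s^-3. This lets a solution outside the
    unit circle be replaced by one inside. *)
Lemma trib_inv (s : algC) N : s != 0 ->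
  s ^+ N * trib s = cotrib s -> s^-1 ^+ N * trib s^-1 = cotrib s^-1.
Proof.
move=> s0 e; have t3 : trib s^-1 = s^-1 ^+ 3 * cotrib s.
  by rewrite /trib /cotrib; field.
have c3 : cotrib s^-1 = s^-1 ^+ 3 * trib s by rewrite /trib /cotrib; field.
rewrite t3 c3 -e mulrCA; congr (_ * _).
by rewrite mulrA -exprMn mulVf // expr1n mul1r.
Qed.

Lemma qv_unity (s : algC) k : s ^+ 4 = 1 -> qv (s + s^-1 + 2) k != 0.
Proof.
move=> s4; have s0 : s != 0.
  by apply/eqP => z; move/eqP: s4; rewrite z expr0n eq_sym oner_eq0.
have : (s - 1) * (s + 1) * (s ^+ 2 + 1) = 0.
  by transitivity (s ^+ 4 - 1); [ring|rewrite s4 subrr].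
move/eqP; rewrite !mulf_eq0 -orbA subr_eq0 addr_eq0 => /or3P[] /eqP e.
- rewrite e (_ : 1 + 1^-1 + 2 = 4); last by rewrite invr1; ring.
  by rewrite qv_at4 oppr_eq0 pnatr_eq0 addn1.
- rewrite e (_ : -1 + (-1)^-1 + 2 = 0); last by rewrite invrN1; ring.
  by rewrite qv_at0 pnatr_eq0 addn3.
have -> : s + s^-1 + 2 = 2.
  have -> : s + s^-1 = s^-1 * (s ^+ 2 + 1) by field.
  by rewrite e mulr0 add0r.
by rewrite qv_at2 mulf_neq0 ?signr_eq0 // pnatr_eq0 addn3.
Qed.

(** Lift a zero of p to s. If some conjugate of s is off the unit circle, it or its inverse lies in
    the disc. Otherwise s is a root of unity, and then either s^4 = 1, which [qv_unity] excludes, or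
    x = 1, which the hypothesis on p excludes. *)
Lemma q_divisor_disc_root (p : {poly rat}) k :
  p %| map_poly intr (q k) -> size p != 1%N -> ~~ root (map_poly ratr p) (1 : algC) ->
  exists s : algC, [/\ s != 0, `|s| < 1, s ^+ (4 * k + 5) * trib s = cotrib s
    & root (map_poly ratr p) (s + s^-1 + 2)].
Proof.
move=> p_q sp p1.
have rq (x : algC) : root (map_poly ratr p) x -> qv x k = 0.
  move=> px; have /rootP : root (map_poly intr (q k)) x; last by [].
  by rewrite -ratr_intr_poly; apply: root_dvdp px; rewrite dvdp_map.
have [x px] : exists x : algC, root (map_poly ratr p) x.
  by apply/closed_rootP; rewrite size_map_poly.
have [s s0 Dx] := joukowski_surj x.
have Es := q_root_trib s0 (etrans (congr1 (qv^~ k) (esym Dx)) (rq x px)).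
have sPs : root (map_poly intr (salem_poly k)) s.
  by apply/rootP; rewrite salem_polyE Es subrr.
have Zs : s \in Aint.
  apply: root_monic_Aint sPs _ _.
    by rewrite monicE lead_coef_map_inj ?(monicP (salem_poly_monic k)) //; exact: intr_inj.
  by apply/polyOverP => i; rewrite coef_map /= intr_int.
have [m [Dm mon_m] min_m] := minCpolyP s.
(* Rational polynomials vanishing at s vanish at its conjugates. For [salem_poly], whose value at 0
   is -1, this gives t != 0; for [joukowski_poly p] it gives a zero of p. *)
have conjP (t : algC) : root (minCpoly s) t -> t != 0 /\ root (map_poly ratr p) (t + t^-1 + 2).
  rewrite Dm => mt; have lift (g : {poly rat}) :
      root (map_poly ratr g) s -> root (map_poly ratr g) t.
    by rewrite min_m => m_g; apply: root_dvdp mt; rewrite dvdp_map.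
  have t0 : t != 0.
    apply/eqP => z; have := lift (map_poly intr (salem_poly k)).
    rewrite ratr_intr_poly => /(_ sPs)/rootP; rewrite salem_polyE z /trib /cotrib.
    rewrite !expr0n addn_eq0 andbF /= mul0r !subr0 => /eqP.
    by rewrite sub0r oppr_eq0 oner_eq0.
  split=> //; have := lift (joukowski_poly p).
  rewrite /root !joukowski_polyE // !mulf_eq0 !expf_eq0 (negPf t0) (negPf s0).
  by rewrite !andbF /= -Dx; apply.
have [rs Drs] := closed_field_poly_normal (minCpoly s).
rewrite (monicP (minCpoly_monic s)) scale1r in Drs.
have rsE (t : algC) : root (minCpoly s) t = (t \in rs) by rewrite Drs root_prod_XsubC.
have [/hasP[t t_rs t1]|] := boolP (has (fun t => `|t| != 1) rs).
  have [t0 pt] : t != 0 /\ root (map_poly ratr p) (t + t^-1 + 2).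
    by apply: conjP; rewrite rsE.
  have Et := q_root_trib t0 (rq _ pt).
  have : (`|t| < 1) || (1 < `|t|).
    by rewrite -real_neqr_lt ?normr_real ?real1.
  case/orP => lt; first by exists t.
  exists t^-1; split; rewrite ?invr_eq0 //.
  - by rewrite normfV invf_lt1 // normr_gt0.
  - exact: trib_inv.
  by rewrite invrK [t^-1 + t]addrC.
rewrite -all_predC => /allP all1.
have [n n0 sn] : exists2 n, (0 < n)%N & s ^+ n = 1.
  apply: kronecker_unity => // t; rewrite rsE => /all1 /=.
  by rewrite negbK => /eqP->.
have [s4|s3] := trib_unity n0 sn Es.
  by have := qv_unity k s4; rewrite -Dx rq // eqxx.
case/negP: p1; rewrite (_ : 1 = x) // Dx.
have -> : s + s^-1 = s^-1 * (s ^+ 2 + s + 1) - 1 by field.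
by rewrite s3; ring.
Qed.

(** * Irreducibility of [r] *)

Lemma q_root1 k : (k %% 3 == 1)%N -> r k * ('X - 1) = q k.
Proof.
move=> k1; rewrite /r k1.
have mX : ('X - 1 : {poly int}) \is monic by rewrite -polyC1 monicXsubC.
have : root (q k) 1.
  have := qv_at1 int k; rewrite (eqP k1) subrr /qv => e.
  by apply/rootP; rewrite -[RHS]e; congr _.[1]; apply/polyP => i; rewrite coef_map /= intz.
by move/factor_theorem=> [u ->]; rewrite polyC1 Pdiv.IdomainMonic.mulpK.
Qed.

Lemma r_notmod3 k : (k %% 3 != 1)%N -> r k = q k.
Proof. by rewrite /r => /negPf->. Qed.

Lemma r_monic_size k : r k \is monic /\ (1 < size (r k))%N.
Proof.
have [mq sq] := q_monic_size k.
have [k1|k1] := boolP (k %% 3 == 1)%N; last by rewrite r_notmod3 // sq addn3.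
have mX : ('X - 1 : {poly int}) \is monic by rewrite -polyC1 monicXsubC.
have Dq := q_root1 k1; have mr : r k \is monic by rewrite -(monicMr _ mX) Dq.
split=> //; have := sq; rewrite -Dq size_Mmonic ?monic_neq0 //.
by rewrite -polyC1 size_XsubC; lia.
Qed.

Lemma r_dvd_q k : exists c : {poly int}, q k = r k * c.
Proof.
have [k1|k1] := boolP (k %% 3 == 1)%N.
  by exists ('X - 1); rewrite q_root1.
by exists 1; rewrite mulr1 r_notmod3.
Qed.

(** When k = 1 modulo 3, differentiating q = r (X - 1) at 1 gives q'(1) = r(1), which is nonzero
    because 1 is a simple zero of q. Otherwise q(1) itself is nonzero. *)
Lemma r_root1 k : ~~ root (map_poly intr (r k)) (1 : algC).
Proof.
have [k1|k1] := boolP (k %% 3 == 1)%N.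
  have q1 : qv (1 : algC) k = 0 by rewrite qv_at1 (eqP k1) subrr.
  have := q_simple_root (rpred1 _) q1.
  rewrite /dqv -(q_root1 k1) rmorphM rmorphB rmorph1 /= map_polyX.
  rewrite derivM derivB derivX derivC !hornerE subrr mulr0 add0r.
  by rewrite subr0 mulr1 => r1; apply/negP => /rootP; apply/eqP.
by rewrite r_notmod3 // /root -/(qv _ _) qv_at1 subr_eq0 pnatr_eq1.
Qed.

Lemma r_irreducible k : irreducible_poly (map_poly (intr : int -> rat) (r k)).
Proof.
have [mr sr] := r_monic_size k.
split; first by rewrite size_map_inj_poly //; exact: intr_inj.
move=> u su /dvdpP[v Dr]; have [c Dq] := r_dvd_q k.
have disc_root (w : {poly rat}) : w %| map_poly intr (r k) -> size w != 1%N ->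
    exists s : algC, [/\ s != 0, `|s| < 1, s ^+ (4 * k + 5) * trib s = cotrib s
      & root (map_poly ratr w) (s + s^-1 + 2)].
  move=> w_r sw; apply: q_divisor_disc_root => //.
    by rewrite Dq rmorphM dvdp_mulr.
  apply: contra (r_root1 k); rewrite -ratr_intr_poly.
  by apply: root_dvdp; rewrite dvdp_map.
rewrite /eqp [X in X && _](_ : _ = true); last by rewrite Dr dvdp_mull.
have [sv|sv] := eqVneq (size v) 1%N.
  have /size_poly1P[a a0 Dv] : size v == 1%N by rewrite sv.
  by rewrite Dr Dv mul_polyC dvdpZl ?dvdpp.
have [s [s0 s1 Es us]] : exists s : algC, [/\ s != 0, `|s| < 1,
    s ^+ (4 * k + 5) * trib s = cotrib s & root (map_poly ratr u) (s + s^-1 + 2)].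
  by apply: disc_root su; rewrite Dr dvdp_mull.
have [t [t0 t1 Et vt]] : exists s : algC, [/\ s != 0, `|s| < 1,
    s ^+ (4 * k + 5) * trib s = cotrib s & root (map_poly ratr v) (s + s^-1 + 2)].
  by apply: disc_root sv; rewrite Dr dvdp_mulr.
(* Uniqueness in the disc gives u and v a common zero x, which is then a double zero of [q k]. *)
have st : t = s by apply: trib_disc_unique Et Es; rewrite ?addn_gt0 ?orbT.
move: us vt; rewrite st; move: (s + s^-1 + 2) => x /rootP us /rootP vt.
have DqC : map_poly intr (q k)
    = map_poly ratr v * map_poly ratr u * map_poly intr c :> {poly algC}.
  by rewrite Dq rmorphM /= -(ratr_intr_poly (r k)) Dr rmorphM.
have qx : qv x k = 0 by rewrite /qv DqC !hornerM us mulr0 mul0r.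
have Zx : x \in Aint.
  have [mq _] := q_monic_size k.
  apply: (@root_monic_Aint (map_poly intr (q k))); first exact/rootP.
    by rewrite monicE lead_coef_map_inj ?(monicP mq) //; exact: intr_inj.
  by apply/polyOverP => i; rewrite coef_map /= intr_int.
have := q_simple_root Zx qx.
rewrite /dqv DqC !derivM !(hornerD, hornerM) us vt.
by rewrite !(mulr0, mul0r, addr0) eqxx.
Qed.

(** * The largest real zero *)

(** This shows that the largest zero is not the zero 1 of the removed factor. The value at 4 is
    negative; at 5 the multiplier is 7 and the values increase from a positive start, so a zero lies
    between. *)
Lemma q_root_gt1 (R : rcfType) k : exists2 y : R, 1 < y & qv y k = 0.
Proof.
have q5 : 0 < qv (5 : R) k.
  suff [] : 0 < qv (5 : R) k /\ qv (5 : R) k < qv 5 k.+1 by [].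
  elim: k => [|k [IH1 IH2]]; first by rewrite qv0 qv1; split; lra.
  by rewrite qvS; split; lra.
have [] := @poly_ivt R (map_poly intr (q k)) 4 5 _ _.
- by rewrite ler_nat.
- rewrite -/(qv 4 k) -/(qv 5 k) qv_at4 (ltW q5) andbT oppr_le0; exact: ler0n.
move=> y /andP[y4 _] /rootP qy; exists y => //.
by apply: lt_le_trans y4; rewrite ltr1n.
Qed.

(** The first conjunct says that the division defining [r] is exact. The other three together
    express that [r k] is the minimal polynomial of the largest zero. *)
Theorem mainTheorem2 (k : nat) :
  ((k %% 3 == 1)%N -> r k * ('X - 1) = q k) /\
  r k \is monic /\
  irreducible_poly (map_poly (intr : int -> rat) (r k)) /\
  (forall (R : rcfType) (d : R),
      root (map_poly intr (q k)) d ->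
      (forall y : R, root (map_poly intr (q k)) y -> y <= d) ->
      root (map_poly intr (r k)) d).
Proof.
split; first exact: q_root1.
split; first by have [] := r_monic_size k.
split; first exact: r_irreducible.
move=> R d qd max_d.
have [k1|k1] := boolP (k %% 3 == 1)%N; last by rewrite r_notmod3.
move: qd; rewrite -(q_root1 k1) rmorphM rmorphB rmorph1 /= map_polyX rootM.
rewrite -polyC1 root_XsubC => /orP[//|/eqP d1].
have [y y1 /rootP/max_d] := q_root_gt1 R k.
by rewrite d1 leNgt y1.
Qed.
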